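(* Let $\Bbbk$ be an algebraically closed field with $\operatorname{char}\Bbbk = 3$. Then: (1) $(\mathbb{P}^1, \mathcal{O}_{\mathbb{P}^1}(d))$ satisfies property $\mathsf{QR}(3)$ for all $d\ge 2$. (2) For a positive integer $n$, $(\mathbb{P}^n, \mathcal{O}_{\mathbb{P}^n}(2))$ satisfies property $\mathsf{QR}(3)$ if and only if $n\le 2$.
   Context: $\mathbb{P}^n$ denotes projective space over $\Bbbk$. The rank of a quadric (homogeneous quadratic polynomial) over a field of characteristic $\neq 2$ is the rank of its associated symmetric matrix. A closed subscheme $X\subset \mathbb{P}^r$ satisfies property $\mathsf{QR}(k)$ if its homogeneous ideal $I(X)$ is generated by quadrics of rank at most $k$. For a very ample line bundle $L$ on a projective scheme $X$, $(X,L)$ satisfies property $\mathsf{QR}(k)$ if the linearly normal embedding $X\subset \mathbb{P}H^0(X,L)$ does. For $(\mathbb{P}^n,\mathcal{O}_{\mathbb{P}^n}(d))$ this embedding is the $d$th Veronese embedding $\nu_d:\mathbb{P}^n\to\mathbb{P}^N$, $N=\binom{n+d}{n}-1$. *)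

(* Defs.v *)
From HB Require Import structures.
From mathcomp Require Import all_boot all_order all_algebra.
From mathcomp Require Export mpoly.

Set Implicit Arguments.
Unset Strict Implicit.
Unset Printing Implicit Defensive.

Import GRing.Theory.
Local Open Scope ring_scope.

Section Ideals.
Context (A : comNzRingType).

Definition ideal_gen (S : A -> Prop) (f : A) : Prop :=
  exists s : seq (A * A),
    (forall c, c \in s -> S c.2) /\ f = \sum_(c <- s) c.1 * c.2.

Definition ideal_generated_by (I S : A -> Prop) : Prop :=
  forall f, I f <-> ideal_gen S f.

End Ideals.

Section Quadrics.
Context (K : fieldType) (m : nat).

(* The zero polynomial counts as a quadric, of rank 0. The matrix is the one of
   the quadratic form only when 2 is invertible in K. *)
Definition quadric_mx (q : {mpoly K[m]}) : 'M[K]_m :=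
  \matrix_(i, j) (if i == j then q@_(U_(i) *+ 2)
                  else q@_(U_(i) + U_(j)) / 2%:R).

Definition quadric_rank (q : {mpoly K[m]}) : nat := \rank (quadric_mx q).

Definition quadric_rank_le (k : nat) (q : {mpoly K[m]}) : Prop :=
  q \is 2.-homog /\ (quadric_rank q <= k)%N.

Lemma quadric_mx_sym q : (quadric_mx q)^T = quadric_mx q.
Proof.
apply/matrixP => i j; rewrite !mxE eq_sym; case: eqP => [->//|_].
by rewrite addmC.
Qed.

Lemma quadric_mxE q : 2%:R != 0 :> K -> q \is 2.-homog ->
  q = \sum_i \sum_j quadric_mx q i j *: ('X_i * 'X_j).
Proof.
have eqU (a b i j : 'I_m) : (U_(i) + U_(j) == U_(a) + U_(b))%MM =
    ((i == a) && (j == b)) || ((i == b) && (j == a)).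
  have Uinj (k l : 'I_m) : (U_(k) = U_(l))%MM -> k = l.
    by move/mnmP/(_ k); rewrite !mnmE eqxx; case: (l =P k).
  apply/eqP/orP => [e|[]/andP[/eqP-> /eqP->]//]; last by rewrite addmC.
  move: (e) => /mnmP/(_ i); rewrite !mnmE eqxx.
  case: (a =P i) => [eai _|_].
    left; rewrite -eai eqxx /=; apply/eqP/Uinj/(@addmI _ U_(i)%MM).
    by rewrite e eai.
  case: (b =P i) => [ebi _|_ //]; right; rewrite -ebi eqxx /=.
  by apply/eqP/Uinj/(@addmI _ U_(i)%MM); rewrite e ebi addmC.
move=> nz2 hq; apply/mpolyP => u; rewrite raddf_sum /=.
transitivity (\sum_i \sum_j quadric_mx q i j * (U_(i) + U_(j) == u)%MM%:R);
  last first.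
  apply: eq_bigr => i _; rewrite raddf_sum /=; apply: eq_bigr => j _.
  by rewrite mcoeffZ -mpolyXD mcoeffX.
have [|ne2] := boolP (mdeg u == 2%N); last first.
  rewrite (dhomog_nemf_coeff hq ne2) big1 // => i _; rewrite big1 // => j _.
  have [e|_] := eqVneq (U_(i) + U_(j))%MM u; last by rewrite mulr0.
  by rewrite -e mdegD !mdeg1 in ne2.
rewrite basis_cover => /mapP[[[|a [|b []]]] //= _ _ ->].
have -> : s2m [:: a; b] = (U_(a) + U_(b))%MM.
  by apply/mnmP => i; rewrite !mnmE /= addn0.
pose F i j := quadric_mx q i j * (U_(i) + U_(j) == U_(a) + U_(b))%MM%:R.
have F0 i j : ~~ (((i == a) && (j == b)) || ((i == b) && (j == a))) -> F i j = 0.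
  by rewrite /F eqU => /negbTE ->; rewrite mulr0.
have rowa : \sum_j F a j = F a b.
  rewrite (bigD1 b) //= big1 ?addr0 // => j /negbTE nj; apply: F0.
  rewrite eqxx nj /=; apply/negP => /andP[/eqP eab /eqP eja].
  by rewrite eja eab eqxx in nj.
rewrite -[RHS]/(\sum_i \sum_j F i j) (bigD1 a) //= rowa.
have Fab : F a b = quadric_mx q a b by rewrite /F eqxx mulr1.
have Fba : F b a = quadric_mx q a b.
  by rewrite /F addmC eqxx mulr1 -[in LHS]quadric_mx_sym mxE.
rewrite Fab; have [eab|neab] := eqVneq a b.
  rewrite big1 ?addr0 ?mxE ?eab ?eqxx ?mulm2n // => i ni.
  by rewrite big1 // => j _; apply: F0; rewrite eab (negbTE ni).
rewrite (bigD1 b) 1?eq_sym //= (bigD1 a) //= Fba big1 => [|j nj]; last first.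
  by apply: F0; rewrite (negbTE nj) andbF eq_sym (negbTE neab).
rewrite big1 => [|i /andP[/negbTE nia /negbTE nib]]; last first.
  by rewrite big1 // => j _; apply: F0; rewrite nia nib.
rewrite !addr0 mxE (negbTE neab) -mulrDr -mulr2n -[_ *+ 2]mulr_natl.
by rewrite mulfV // mulr1.
Qed.

End Quadrics.

(* A subset of P^r is a predicate on homogeneous coordinates; only its values
   at nonzero vectors matter, and it is meant to be invariant under scaling. *)
Section ProjectiveSubsets.
Context (K : fieldType) (r : nat).

Definition vanishing_form (X : 'rV[K]_r.+1 -> Prop) (f : {mpoly K[r.+1]}) :=
  (exists e, f \is e.-homog) /\
  forall x : 'rV[K]_r.+1, x != 0 -> X x -> f.@[fun i => x 0 i] = 0.

Definition homog_ideal (X : 'rV[K]_r.+1 -> Prop) : {mpoly K[r.+1]} -> Prop :=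
  ideal_gen (vanishing_form X).

Definition property_QR (k : nat) (X : 'rV[K]_r.+1 -> Prop) : Prop :=
  exists S : {mpoly K[r.+1]} -> Prop,
    (forall q, S q -> quadric_rank_le k q) /\
    ideal_generated_by (homog_ideal X) S.

End ProjectiveSubsets.

(* (P^n, O(d)) is embedded in P(H^0(P^n, O(d))) through the monomial basis of the
   forms of degree d in n + 1 variables (s2m turns a sorted d-tuple of variable
   indices into the exponent of their product). *)
Section Veronese.
Context (K : fieldType) (n d : nat).

Definition veronese_dim : nat := 'C(n + d, n).-1.

Definition degree_monomials : seq 'X_{1..n.+1} :=
  [seq s2m t | t : d.-tuple 'I_n.+1 <- enum (basis n.+1 d)].

Definition veronese_monomial (i : 'I_veronese_dim.+1) : 'X_{1..n.+1} :=
  nth 0%MM degree_monomials i.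

Definition veronese_map (v : 'rV[K]_n.+1) : 'rV[K]_veronese_dim.+1 :=
  \row_i 'X_[veronese_monomial i].@[fun j => v 0 j].

Definition veronese_variety (x : 'rV[K]_veronese_dim.+1) : Prop :=
  exists2 v : 'rV[K]_n.+1, v != 0 &
    exists2 c : K, c != 0 & x = c *: veronese_map v.

End Veronese.

Definition Pn_Od_property_QR (K : fieldType) (n d k : nat) : Prop :=
  property_QR k (@veronese_variety K n d).

Lemma size_degree_monomials n d :
  size (degree_monomials n d) = (veronese_dim n d).+1.
Proof.
rewrite size_basis /veronese_dim prednK ?bin_gt0 ?leq_addr //.
by rewrite -(bin_sub (leq_addr d n)) addKn addnC.
Qed.

Lemma veronese_monomial_inj n d : injective (@veronese_monomial n d).
Proof.
move=> i j /eqP; rewrite nth_uniq ?size_degree_monomials ?uniq_basis //.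
by move/eqP/val_inj.
Qed.

Lemma veronese_monomialP n d (m : 'X_{1..n.+1}) :
  reflect (exists i, m = @veronese_monomial n d i) (mdeg m == d).
Proof.
rewrite basis_cover -/(degree_monomials n d); apply: (iffP idP) => [|[i ->]].
  move=> /(nthP 0%MM)[i]; rewrite size_degree_monomials => lti <-.
  by exists (Ordinal lti).
by rewrite mem_nth ?size_degree_monomials.
Qed.

Section Kernel.
Context (K : closedFieldType).

Lemma mpoly_eval0 n (p : {mpoly K[n]}) : (forall v, p.@[v] = 0) -> p = 0.
Proof.
elim: n p => [|n IHn] p p0.
  have := p0 (fun=> 0); rewrite mevalE => e.
  apply/mpolyP => m; rewrite mcoeff0.
  have [ms|/memN_msupp_eq0//] := boolP (m \in msupp p).
  rewrite -[RHS]e (bigD1_seq m) ?msupp_uniq //= big_ord0 mulr1 big1 ?addr0 //.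
  by move=> m' /eqP []; apply/mnmP => -[].
pose ext (v : 'I_n -> K) t i := oapp v t (unlift ord_max i).
have widE j : widen_ord (leqnSn n) j = lift ord_max j.
  by apply/val_inj; rewrite /= /bump leqNgt ltn_ord.
have evalE v t : (map_poly (meval v) (muni p)).[t] = p.@[ext v t].
  rewrite muniE mevalE rmorph_sum horner_sum /=; apply: eq_bigr => m _.
  rewrite -mul_polyC rmorphM /= map_polyC map_polyXn hornerM hornerC hornerXn /=.
  rewrite mevalZ mevalX -mulrA big_ord_recr /= /ext unlift_none /=.
  congr (_ * (_ * _)); apply: eq_bigr => j _.
  by rewrite mnmE widE liftK.
have muni0 : muni p = 0.
  apply/polyP => k; rewrite coef0; apply: IHn => v.
  rewrite -coef_map; suff -> : map_poly (meval v) (muni p) = 0 by rewrite coef0.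
  apply/eqP/negPn/closed_nonrootP => -[t]; rewrite /root evalE.
  by rewrite p0 eqxx.
apply/mpolyP => m; rewrite mcoeff0.
pose res (m : 'X_{1..n.+1}) := [multinom m (widen_ord (leqnSn n) i) | i < n].
have resE m1 m2 : (m1 == m2) = (res m1 == res m2) && (m1 ord_max == m2 ord_max).
  apply/eqP/andP => [->//|[/eqP/mnmP e1 /eqP e2]]; apply/mnmP => i.
  case: (unliftP ord_max i) => [j ->|->//].
  by have := e1 j; rewrite !mnmE widE.
have := congr1 (fun q : {poly {mpoly K[n]}} => (q`_(m ord_max))@_(res m)) muni0.
rewrite /= coef0 mcoeff0 => e; rewrite -[RHS]e muniE coef_sum raddf_sum /=.
rewrite {1}[p]mpolyE raddf_sum /=; apply: eq_bigr => m' _.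
rewrite coefZ coefXn mcoeffZ mcoeffX resE [m ord_max == _]eq_sym.
case: (m' ord_max =P m ord_max) => _; last by rewrite andbF !mulr0 mcoeff0.
by rewrite andbT mulr1 mcoeffZ mcoeffX.
Qed.

(* The homogeneous ideal of the scheme-theoretic image of the embedding is the
   kernel of the substitution of the degree-d monomials; it agrees with the
   ideal of forms vanishing on the set of points. *)
Lemma homog_ideal_veroneseE n d (f : {mpoly K[(veronese_dim n d).+1]}) :
  (0 < d)%N ->
  homog_ideal (@veronese_variety K n d) f <->
  f \mPo [tuple 'X_[veronese_monomial i] | i < (veronese_dim n d).+1] = 0.
Proof.
set t := [tuple _ | _ < _] => d_gt0.
have evt (g : {mpoly K[(veronese_dim n d).+1]}) (v : 'rV[K]_n.+1) :
    (g \mPo t).@[fun j => v 0 j] = g.@[fun i => veronese_map d v 0 i].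
  by rewrite comp_mpoly_meval; apply: meval_eq => i; rewrite tnth_mktuple mxE.
split=> [[s [s_van ->]]|ft0].
  rewrite raddf_sum /= big_seq big1 // => c /s_van[_ c0].
  rewrite rmorphM /=; suff -> : c.2 \mPo t = 0 by rewrite mulr0.
  apply/eqP; have: 'X_ord0 * (c.2 \mPo t) == 0.
    apply/eqP/mpoly_eval0 => v; rewrite mevalM mevalXU.
    pose w : 'rV[K]_n.+1 := \row_j v j.
    have [->|v0] := eqVneq (v ord0) 0; first by rewrite mul0r.
    have wnz : w != 0 by apply: contra v0 => /eqP/rowP/(_ ord0); rewrite !mxE => ->.
    have -> : (c.2 \mPo t).@[v] = (c.2 \mPo t).@[fun j => w 0 j].
      by apply: meval_eq => j; rewrite mxE.
    rewrite evt c0 ?mulr0 //; last first.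
      by exists w => //; exists 1; rewrite ?oner_eq0 ?scale1r.
    have md : mdeg (U_(ord0 : 'I_n.+1) *+ d) == d by rewrite mdegMn mdeg1 mul1n.
    have [i ei] := veronese_monomialP d _ md.
    apply: contra v0 => /eqP/rowP/(_ i); rewrite !mxE -ei mevalX.
    rewrite (bigD1 ord0) //= big1 => [|j /negbTE nj]; last first.
      by rewrite mulmnE mnm1E eq_sym nj mul0n.
    by rewrite mulr1 mulmnE mnm1E eqxx mul1n mxE => /eqP; rewrite expf_eq0 => /andP[].
  rewrite mulf_eq0 => /orP[/eqP/mpolyP/(_ U_(ord0)%MM)|//].
  by rewrite mcoeffX mcoeff0 eqxx => /eqP; rewrite oner_eq0.
have piZ l k c (p : {mpoly K[l]}) :
    pihomog mdeg k (c *: p) = c *: pihomog mdeg k p by exact: linearZ.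
have homt e (g : {mpoly K[(veronese_dim n d).+1]}) :
    pihomog mdeg e g \mPo t = pihomog mdeg (d * e) (g \mPo t).
  rewrite [g]mpolyE (raddf_sum (pihomog mdeg e)) !(raddf_sum (comp_mpoly t)).
  rewrite (raddf_sum (pihomog mdeg (d * e))); apply: eq_bigr => m _.
  rewrite /= piZ !comp_mpolyZ piZ; congr (_ *: _).
  have hm : 'X_[m] \mPo t \is (d * mdeg m).-homog.
    rewrite comp_mpolyX mdegE big_distrr /=.
    apply: (big_ind2 (fun (p : {mpoly K[n.+1]}) k => p \is k.-homog)).
    - exact: dhomog1.
    - by move=> p1 k1 p2 k2 h1 h2; apply: dhomogM.
    move=> i _; rewrite tnth_mktuple; apply: dhomogMn; rewrite dhomogX.
    by apply/veronese_monomialP; exists i.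
  rewrite pihomogX; have [<-|ne] := eqVneq (mdeg m) e; first by rewrite pihomog_dE.
  by rewrite comp_mpoly0 (pihomog_ne0 _ hm) // eqn_mul2l negb_or -lt0n d_gt0.
exists [seq (1, pihomog mdeg (val e) f) | e : 'I_(msize f)]; split; last first.
  rewrite big_map big_enum /= {1}(pihomog_partitionE (leqnn (msize f))).
  by apply: eq_bigr => e _; rewrite mul1r.
move=> _ /mapP[e _ ->]; split=> [|_ _ [v _ [c _ ->]]] /=.
  by exists e; apply: pihomogP.
have := pihomogP mdeg e f; have := homt e f; rewrite ft0 pihomog0.
move: (pihomog _ _ _) => g gt0 /dhomogP hg.
have -> : g.@[fun i => (c *: veronese_map d v) 0 i] =
    c ^+ e * g.@[fun i => veronese_map d v 0 i].
  rewrite !mevalE mulr_sumr big_seq [RHS]big_seq; apply: eq_bigr => m /hg em.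
  have {em} -> : e = mdeg m :> nat by rewrite -em.
  rewrite mulrCA; congr (_ * _); rewrite mdegE -prodrXr -big_split /=.
  by apply: eq_bigr => i _; rewrite mxE exprMn.
by rewrite -evt gt0 meval0 mulr0.
Qed.

End Kernel.

(* Main.v *)
Require Import Defs.
From mathcomp Require Import all_boot all_order all_algebra.
From mathcomp Require Import ring zify.

Import GRing.Theory.
Local Open Scope ring_scope.

(** Quadrics of rank at most 3 in the ideal of the Veronese variety come from
    triples of forms of degree d with F1 F2 = F3^2: if l1, l2, l3 are the linear
    forms on the ambient space that restrict to F1, F2, F3, then l1 l2 - l3^2 is
    such a quadric ([lift_square]).

    Positive results.  The ideal of any Veronese variety is generated by the
    binomials that exchange one variable between two monomials of degree d
    ([veronese_kernel_sub], [QR3_of_moves]): two products of degree-d monomials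
    with the same value are linked by such exchanges.  It remains to write the
    exchanges in terms of the quadrics above.  On the line, one takes
    F1, F2, F3 = g s^2, g t^2, g s t and polarises in g; this gives the second
    differences of the products x_i x_(w-i) for each weight w, and together with
    the centred ones these generate all the differences ([QR3_P1]).  For d = 2
    the exchanges are the minors of the symmetric matrix (y_ij); polarising
    y_ii y_jj - y_ij^2 gives those with a row index equal to a column index,
    which for n <= 2 is all of them ([QR3_deg2]).

    Negative result.  For d = 2, over an algebraically closed field in which 2
    is invertible, a quadric of rank at most 3 in the ideal is a sum of three
    squares, hence l1 l2 - l3^2, and the restrictions satisfy F1 F2 = F3^2.
    Such a triple is either proportional to a single form or of the shape
    u^2, w^2, u w ([product_square_forms]).  In the first case the coefficients
    of y_01 y_23 and y_02 y_13 in the quadric vanish.  In the second one the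
    coefficient of y_ij y_kl is a combination of the six products of two
    coefficients of u and two of w with indices i, j, k, l, and in
    characteristic 3 all six have the same weight ([char3_symmetry]).  So
    y_01 y_23 and y_02 y_13 have the same coefficient in every such quadric, and
    y_01 y_23 - y_02 y_13, which is in the ideal as soon as n >= 3, is not in the
    ideal generated by them ([not_QR3_deg2]). *)

(** * Ideals *)

Section IdealGen.
Context (A : comNzRingType) (S : A -> Prop).
Implicit Types f g h : A.

Lemma ideal_gen0 : ideal_gen S 0.
Proof. by exists [::]; split=> //; rewrite big_nil. Qed.

Lemma ideal_gen_in f : S f -> ideal_gen S f.
Proof.
move=> Sf; exists [:: (1, f)]; split; last by rewrite big_seq1 mul1r.
by move=> c; rewrite inE => /eqP->.
Qed.

Lemma ideal_genD f g : ideal_gen S f -> ideal_gen S g -> ideal_gen S (f + g).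
Proof.
move=> [s [Ss ->]] [t [St ->]]; exists (s ++ t); split; last by rewrite big_cat.
by move=> c; rewrite mem_cat => /orP[/Ss|/St].
Qed.

Lemma ideal_genM f g : ideal_gen S g -> ideal_gen S (f * g).
Proof.
move=> [s [Ss ->]]; exists [seq (f * c.1, c.2) | c <- s]; split.
  by move=> _ /mapP[c /Ss Sc ->].
by rewrite big_map mulr_sumr; apply: eq_bigr => c _; rewrite mulrA.
Qed.

Lemma ideal_genN f : ideal_gen S f -> ideal_gen S (- f).
Proof. by rewrite -mulN1r; apply: ideal_genM. Qed.

Lemma ideal_genB f g : ideal_gen S f -> ideal_gen S g -> ideal_gen S (f - g).
Proof. by move=> Sf Sg; apply/ideal_genD/ideal_genN. Qed.

Lemma ideal_gen_sum (I : eqType) (r : seq I) (F : I -> A) :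
  (forall i, i \in r -> ideal_gen S (F i)) -> ideal_gen S (\sum_(i <- r) F i).
Proof.
rewrite big_seq => rF; elim/big_ind: _ => //; first exact: ideal_gen0.
exact: ideal_genD.
Qed.

Lemma ideal_gen_trans g f h :
  ideal_gen S (f - g) -> ideal_gen S (g - h) -> ideal_gen S (f - h).
Proof. by move=> fg gh; rewrite -(subrKA g f); apply: ideal_genD. Qed.

End IdealGen.

(** * Generators of the Veronese ideal *)

Section Moves.
Context (K : fieldType) (n d : nat) (d_gt0 : (0 < d)%N).
Local Notation N := (veronese_dim n d).
Local Notation mon := (@veronese_monomial n d).
Implicit Types (u w : 'X_{1..N.+1}) (i j k l : 'I_N.+1).

Lemma mdeg_veronese_monomial i : mdeg (mon i) = d.
Proof. by apply/eqP/veronese_monomialP; exists i. Qed.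

(** The exponent of the image of X^u under the substitution of the degree-d
    monomials for the coordinates. *)
Definition image_monomial u : 'X_{1..n.+1} := (\sum_i mon i *+ u i)%MM.

Lemma image_monomialD u w :
  image_monomial (u + w) = (image_monomial u + image_monomial w)%MM.
Proof.
rewrite /image_monomial -big_split /=; apply: eq_bigr => i _.
by apply/mnmP => a; rewrite !(mnmDE, mulmnE) mulnDr.
Qed.

Lemma image_monomialU i : image_monomial U_(i) = mon i.
Proof.
rewrite /image_monomial (bigD1 i) //= big1 ?addm0 => [|j /negbTE nj].
  by rewrite mnm1E eqxx mulm1n.
by rewrite mnm1E eq_sym nj mulm0n.
Qed.

Lemma mdeg_image_monomial u : mdeg (image_monomial u) = (d * mdeg u)%N.
Proof.
rewrite mdeg_sum mdegE big_distrr /=; apply: eq_bigr => i _.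
by rewrite mdegMn mdeg_veronese_monomial.
Qed.

Definition veronese_tuple : N.+1.-tuple {mpoly K[n.+1]} :=
  [tuple 'X_[mon i] | i < N.+1].

Lemma veronese_substX u : 'X_[u] \mPo veronese_tuple = 'X_[image_monomial u].
Proof.
rewrite comp_mpolyX.
rewrite (big_morph (fun m => 'X_[m] : {mpoly K[n.+1]}) (@mpolyXD _ _) (mpolyX0 _ _)).
by apply: eq_bigr => i _; rewrite tnth_mktuple mpolyXn.
Qed.

(** From here on [J] is any family whose ideal contains the binomials obtained
    by exchanging one variable [x_a] of a monomial for one variable [x_b] of
    another. *)
Context (J : {mpoly K[N.+1]} -> Prop).
Context (J_moves : forall (p p' : 'X_{1..n.+1}) (a b : 'I_n.+1) i l i' l',
  mon i = (p + U_(a))%MM -> mon l = (p' + U_(b))%MM ->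
  mon i' = (p + U_(b))%MM -> mon l' = (p' + U_(a))%MM ->
  ideal_gen J ('X_i * 'X_l - 'X_i' * 'X_l')).

Lemma mpolyXB_cancel w u u' :
  ideal_gen J ('X_[u] - 'X_[u']) -> ideal_gen J ('X_[w + u] - 'X_[w + u']).
Proof. by rewrite !mpolyXD -mulrBr; apply: ideal_genM. Qed.

Lemma mnm_splitU m (p : 'X_{1..m}) (a : 'I_m) :
  (0 < p a)%N -> exists p', p = (p' + U_(a))%MM.
Proof.
by rewrite lt0n -lep1mP => le_a; exists (p - U_(a))%MM; rewrite submK.
Qed.

(** If [mon k] divides the image of X_i X^u, exchanges turn X_i into X_k: as
    long as [mon i] differs from [mon k], it has too few [x_b] and too many
    [x_a], and the missing [x_b] occurs in some other factor, which can trade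
    it for the [x_a].  Each trade decreases the degree of [mon k - mon i], the
    truncated difference. *)
Lemma bring_to_front k u i : (mon k <= image_monomial (U_(i) + u))%MM ->
  exists w, image_monomial (U_(k) + w) = image_monomial (U_(i) + u) /\
    ideal_gen J ('X_[U_(i) + u] - 'X_[U_(k) + w]).
Proof.
have [r] := ubnP (mdeg (mon k - mon i)); elim: r => // r IHr in u i *.
rewrite ltnS => le_r le_k.
have [/mnm_lepP le_ki|] := boolP (mon k <= mon i)%MM.
  suff -> : k = i by exists u; split=> //; rewrite subrr; apply: ideal_gen0.
  apply: veronese_monomial_inj; apply/mnmP.
  have : (\sum_a (mon i a - mon k a) = 0)%N.
    by rewrite sumnB // -!mdegE !mdeg_veronese_monomial subnn.
  move/eqP; rewrite sum_nat_eq0 => /forallP le_ik a.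
  by apply/eqP; rewrite eqn_leq le_ki -subn_eq0; apply: le_ik.
rewrite negb_forall => /existsP[b]; rewrite -ltnNge => lt_b.
have [a lt_a] : exists a, (mon k a < mon i a)%N.
  apply/existsP; have [//|] := boolP [exists a, (mon k a < mon i a)%N].
  rewrite negb_exists => /forallP le_ik.
  suff : (mdeg (mon i) < mdeg (mon k))%N by rewrite !mdeg_veronese_monomial ltnn.
  rewrite !mdegE (bigD1 b) //= [ltnRHS](bigD1 b) //= -addSn leq_add //.
  by apply: leq_sum => a _; rewrite leqNgt.
have ne_ab : (a == b) = false by apply/eqP => e; move: lt_a lt_b; rewrite e; lia.
have [p Ep] : exists p, mon i = (p + U_(a))%MM by apply: mnm_splitU; lia.
(* The factor of X^u that supplies the missing x_b. *)
have [l [ul lb]] : exists l, (0 < u l)%N /\ (0 < mon l b)%N.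
  have: (0 < image_monomial u b)%N.
    have := mnm_lepP le_k b; rewrite image_monomialD mnmDE image_monomialU.
    by lia.
  rewrite /image_monomial mnm_sumE lt0n sum_nat_eq0 negb_forall => /existsP[l].
  by rewrite mulmnE muln_eq0 negb_or -!lt0n => /andP[lb ul]; exists l.
have [p' Ep'] := mnm_splitU _ _ _ lb; have [v Ev] := mnm_splitU _ _ _ ul.
have [i' Ei'] : exists i', (p + U_(b))%MM = mon i'.
  apply/veronese_monomialP; rewrite -(mdeg_veronese_monomial i) Ep.
  by rewrite !mdegD !mdeg1.
have [l' El'] : exists l', (p' + U_(a))%MM = mon l'.
  apply/veronese_monomialP; rewrite -(mdeg_veronese_monomial l) Ep'.
  by rewrite !mdegD !mdeg1.
have e1 : image_monomial (U_(i') + (U_(l') + v)) = image_monomial (U_(i) + u).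
  rewrite Ev !image_monomialD !image_monomialU -Ei' -El' Ep Ep'.
  by apply/mnmP => c; rewrite !mnmDE; lia.
have m1 : ideal_gen J ('X_[U_(i) + u] - 'X_[U_(i') + (U_(l') + v)]).
  rewrite Ev; have := J_moves _ _ _ _ _ _ _ _ Ep Ep' (esym Ei') (esym El').
  move/(ideal_genM _ _ 'X_[v]); congr ideal_gen; rewrite !mpolyXD; ring.
have lt_r : (mdeg (mon k - mon i') < r)%N.
  apply: leq_trans le_r; rewrite !mdegE (bigD1 b) //= [ltnRHS](bigD1 b) //=.
  rewrite -addSn leq_add //.
    rewrite !mnmBE -Ei' Ep !mnmDE !mnm1E eqxx ne_ab.
    by move: lt_b; rewrite Ep mnmDE mnm1E ne_ab; lia.
  apply: leq_sum => c nc; rewrite !mnmBE -Ei' Ep !mnmDE !mnm1E.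
  rewrite [b == c]eq_sym (negbTE nc); case: eqP => [<-|_]; last by [].
  by move: lt_a; rewrite Ep mnmDE mnm1E eqxx; lia.
have [|w [ew mw]] := IHr (U_(l') + v)%MM i' lt_r; first by rewrite e1.
by exists w; split; [rewrite ew | apply: ideal_gen_trans mw].
Qed.

(** Induction on the degree: bring a variable of X^w to the front of X^u, then
    cancel it on both sides. *)
Lemma fibre_connected u w : image_monomial u = image_monomial w ->
  ideal_gen J ('X_[u] - 'X_[w]).
Proof.
have [r] := ubnP (mdeg u); elim: r => // r IHr in u w *.
rewrite ltnS => le_r e.
have degE : mdeg u = mdeg w.
  apply/eqP; rewrite -(eqn_pmul2l d_gt0); apply/eqP.
  by rewrite -!mdeg_image_monomial e.
have [w0|] := eqVneq w 0%MM.
  have -> : u = w by rewrite w0; apply/eqP; rewrite -mdeg_eq0 degE w0 mdeg0.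
  by rewrite subrr; apply: ideal_gen0.
rewrite -mdeg_eq0 mdegE sum_nat_eq0 negb_forall => /existsP[k] /=.
rewrite -lt0n => /mnm_splitU[w' Ew].
have : mdeg u != 0%N by rewrite degE Ew mdegD mdeg1 addn1.
rewrite mdegE sum_nat_eq0 negb_forall => /existsP[i] /=.
rewrite -lt0n => /mnm_splitU[u' Eu].
have [|v [ev mv]] := bring_to_front k u' i.
  rewrite addmC -Eu e Ew image_monomialD image_monomialU.
  by apply/mnm_lepP => c; rewrite mnmDE leq_addl.
rewrite Eu addmC; apply: ideal_gen_trans mv _.
rewrite Ew [(w' + _)%MM]addmC; apply: mpolyXB_cancel; apply: IHr.
  apply: leq_trans le_r; have : mdeg (U_(k) + v) = mdeg u.
    apply/eqP; rewrite -(eqn_pmul2l d_gt0) -!mdeg_image_monomial.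
    by rewrite ev [(U_(i) + _)%MM]addmC -Eu.
  by rewrite mdegD mdeg1 => <-.
have : image_monomial (U_(k) + v) = image_monomial (U_(k) + w').
  by rewrite ev [(U_(i) + _)%MM]addmC -Eu e Ew addmC.
by rewrite !image_monomialD => /addmI.
Qed.

(** Let [sec] be the linear map sending each monomial of the form
    [image_monomial u] to one fixed X^u' of the same image.  If f maps to 0,
    then f = f - sec (image of f), a combination of the differences X^u - X^u'
    treated in [fibre_connected].  The bounds [s] and [t] on degrees only make
    the index sets finite. *)
Lemma veronese_kernel_sub f : f \mPo veronese_tuple = 0 -> ideal_gen J f.
Proof.
move=> f0; pose s := msize f; pose t := (d * s)%N.+1.
pose g m : {mpoly K[N.+1]} :=
  oapp (fun u : 'X_{1..N.+1 < s} => 'X_[u]) 0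
    [pick u : 'X_{1..N.+1 < s} | image_monomial u == m].
pose sec (F : {mpoly K[n.+1]}) := \sum_(m : 'X_{1..n.+1 < t}) F@_m *: g m.
have secX m : (mdeg m < t)%N -> sec 'X_[m] = g m.
  move=> lt_m; rewrite /sec (bigD1 (BMultinom lt_m)) //= big1 ?addr0.
    by rewrite mcoeffX eqxx scale1r.
  move=> m' ne; rewrite mcoeffX -[m == _]/(bmnm (BMultinom lt_m) == m') -bmeqP.
  by rewrite eq_sym (negbTE ne) scale0r.
have -> : f = \sum_(u <- msupp f) f@_u *: ('X_[u] - g (image_monomial u)).
  rewrite -[LHS]subr0; under eq_bigr do rewrite scalerBr.
  rewrite sumrB -mpolyE; congr (_ - _); transitivity (sec (f \mPo veronese_tuple)).
    by rewrite f0 /sec big1 // => m _; rewrite mcoeff0 scale0r.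
  rewrite {1}[f]mpolyE raddf_sum /sec /=.
  under eq_bigr do rewrite raddf_sum scaler_suml /=.
  rewrite exchange_big /= big_seq [RHS]big_seq; apply: eq_bigr => u uf.
  rewrite -secX; last first.
    by rewrite ltnS mdeg_image_monomial leq_mul2l ltnW ?orbT ?msize_mdeg_lt.
  rewrite /sec scaler_sumr; apply: eq_bigr => m _.
  by rewrite comp_mpolyZ veronese_substX mcoeffZ scalerA.
apply: ideal_gen_sum => u uf; rewrite -mul_mpolyC; apply: ideal_genM.
rewrite /g; case: pickP => [u' /eqP e|/(_ (BMultinom (msize_mdeg_lt uf)))] /=.
  exact: fibre_connected.
by rewrite eqxx.
Qed.

End Moves.

(** * Quadrics of rank at most three *)

Section RankThree.
Context (K : fieldType) (nz2 : 2%:R != 0 :> K).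

Lemma mnm_addU_eq m (a b i j : 'I_m) : (U_(a) + U_(b) == U_(i) + U_(j))%MM =
  ((a == i) && (b == j)) || ((a == j) && (b == i)).
Proof.
have Uinj (k l : 'I_m) : (U_(k) = U_(l))%MM -> k = l.
  by move/mnmP/(_ k); rewrite !mnm1E eqxx; case: (l =P k).
apply/eqP/orP => [e|[]/andP[/eqP-> /eqP->]//]; last by rewrite addmC.
have := congr1 (fun p : 'X_{1..m} => p a) e; rewrite !mnmDE !mnm1E eqxx.
case: (i =P a) e => [<- /addmI/Uinj -> _|_ e]; first by left; rewrite !eqxx.
case: (j =P a) e => [<-|//]; rewrite [RHS]addmC => /addmI/Uinj -> _.
by right; rewrite !eqxx.
Qed.

Definition linear_form {m} (a : 'rV[K]_m) : {mpoly K[m]} := \sum_i a 0 i *: 'X_i.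

Lemma linear_form_homog m (a : 'rV[K]_m) : linear_form a \is 1.-homog.
Proof.
by apply: rpred_sum => i _; apply: dhomogZ; rewrite dhomogX /= mdeg1.
Qed.

Lemma quadric_mxM m (a b : 'rV[K]_m) :
  quadric_mx (linear_form a * linear_form b) =
  2%:R^-1 *: (a^T *m b + b^T *m a).
Proof.
have coefE i j : (linear_form a * linear_form b)@_(U_(i) + U_(j)) =
    \sum_k \sum_l a 0 k * b 0 l *
      (((k == i) && (l == j)) || ((k == j) && (l == i)))%:R.
  rewrite mulr_suml raddf_sum /=; apply: eq_bigr => k _.
  rewrite mulr_sumr raddf_sum /=; apply: eq_bigr => l _.
  by rewrite -scalerAr -scalerAl scalerA -mpolyXD mcoeffZ mcoeffX mnm_addU_eq
    [b 0 l * _]mulrC.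
have pick i j : \sum_k \sum_l a 0 k * b 0 l * ((k == i) && (l == j))%:R =
    a 0 i * b 0 j.
  rewrite (bigD1 i) //= (bigD1 j) //= !eqxx mulr1.
  rewrite !big1 ?addr0 // => [k /negbTE nk|l /negbTE nl].
    by rewrite big1 // => l _; rewrite nk mulr0.
  by rewrite nl andbF mulr0.
apply/matrixP => i j; rewrite !mxE !big_ord1 !mxE.
have [<-|nij] := eqVneq i j.
  rewrite -[(U_(i) *+ 2)%MM]/(U_(i) + U_(i))%MM coefE; under eq_bigr do under eq_bigr do rewrite orbb.
  by rewrite pick; field.
rewrite coefE mulrC; congr (_ * _).
rewrite [b 0 i * _]mulrC -!pick -big_split /=; apply: eq_bigr => k _.
rewrite -big_split /=; apply: eq_bigr => l _; rewrite -mulrDr -natrD.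
congr (_ * _%:R); case: (k =P i) => [->|_] /=; last by rewrite add0n.
by rewrite (negbTE nij) /= orbF addn0.
Qed.

Lemma quadric_mxB m (p q : {mpoly K[m]}) :
  quadric_mx (p - q) = quadric_mx p - quadric_mx q.
Proof.
by apply/matrixP => i j; rewrite !mxE !mcoeffB; case: eqP => // _; rewrite mulrBl.
Qed.

(** The matrices of the three products involve only the three rows a, b, c:
    they add up to three matrices of rank at most one. *)
Lemma rank_le3 m (a b c : 'rV[K]_m) :
  quadric_rank_le 3 (linear_form a * linear_form b - linear_form c ^+ 2).
Proof.
split.
  have hom2 (u v : 'rV[K]_m) : linear_form u * linear_form v \is 2.-homog.
    by have := dhomogM (linear_form_homog m u) (linear_form_homog m v).
  by rewrite expr2; apply: rpredB; apply: hom2.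
rewrite /quadric_rank quadric_mxB expr2 !quadric_mxM !scalerDr.
have r1 (u v : 'rV[K]_m) : (\rank (u^T *m v) <= 1)%N.
  exact: leq_trans (mxrankM_maxr _ _) (rank_leq_row _).
rewrite -mulr2n -scaler_nat scalerA mulfV // scale1r.
apply: leq_trans (mxrank_add _ _) _; rewrite mxrank_opp.
apply: (@leq_add _ _ 2 1) => //; apply: leq_trans (mxrank_add _ _) _.
by apply: (@leq_add _ _ 1 1); rewrite !mxrank_scale_nz ?invr_eq0.
Qed.

End RankThree.
Arguments linear_form {K m} a.

Section LiftForm.
Context (K : fieldType) (nz2 : 2%:R != 0 :> K) (n d : nat).
Local Notation N := (veronese_dim n d).
Local Notation mon := (@veronese_monomial n d).
Implicit Types F G : {mpoly K[n.+1]}.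

(** The linear form on the space of the Veronese embedding that restricts to a
    given form of degree d, see [lift_formK]. *)
Definition lift_form F : {mpoly K[N.+1]} :=
  linear_form (\row_i F@_(mon i)).

Lemma lift_formD F G : lift_form (F + G) = lift_form F + lift_form G.
Proof.
rewrite /lift_form /linear_form -big_split; apply: eq_bigr => i _ /=.
by rewrite !mxE mcoeffD scalerDl.
Qed.

Lemma lift_formX i : lift_form 'X_[mon i] = 'X_i.
Proof.
rewrite /lift_form /linear_form (bigD1 i) //= big1 => [|j /negbTE nj].
  by rewrite mxE mcoeffX eqxx scale1r addr0.
by rewrite mxE mcoeffX (inj_eq (@veronese_monomial_inj n d)) eq_sym nj scale0r.
Qed.

Lemma lift_formK F : F \is d.-homog -> lift_form F \mPo veronese_tuple K n d = F.
Proof.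
move=> hF; rewrite /lift_form /linear_form raddf_sum /=; apply/mpolyP => m.
rewrite raddf_sum /=.
under eq_bigr do rewrite comp_mpolyZ veronese_substX image_monomialU mcoeffZ mcoeffX mxE.
have [/veronese_monomialP[i ->]|ne] := boolP (mdeg m == d).
  rewrite (bigD1 i) //= big1 ?addr0 ?eqxx ?mulr1 // => j /negbTE nj.
  by rewrite (inj_eq (@veronese_monomial_inj n d)) nj mulr0.
rewrite (dhomog_nemf_coeff hF ne) big1 // => i _; case: eqP => [e|_].
  by rewrite -e mdeg_veronese_monomial eqxx in ne.
by rewrite mulr0.
Qed.

Definition veronese_rank3 (q : {mpoly K[N.+1]}) : Prop :=
  quadric_rank_le 3 q /\ q \mPo veronese_tuple K n d = 0.

(** The source of all the rank 3 quadrics used as generators. *)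
Lemma lift_square F1 F2 F3 :
  F1 \is d.-homog -> F2 \is d.-homog -> F3 \is d.-homog -> F1 * F2 = F3 ^+ 2 ->
  ideal_gen veronese_rank3 (lift_form F1 * lift_form F2 - lift_form F3 ^+ 2).
Proof.
move=> h1 h2 h3 e; apply: ideal_gen_in; split; first exact: rank_le3.
by rewrite raddfB /= expr2 !rmorphM /= !lift_formK // e expr2 subrr.
Qed.

End LiftForm.

(** * Rational normal curves and the cases n <= 2 *)

Section QR.
Context (K : closedFieldType) (nz2 : 2%:R != 0 :> K).

Lemma QR3_of_moves n d : (0 < d)%N ->
  (forall (p p' : 'X_{1..n.+1}) a b, (mdeg p).+1 = d -> (mdeg p').+1 = d ->
    ideal_gen (veronese_rank3 K n d)
      (lift_form K n d 'X_[p + U_(a)] * lift_form K n d 'X_[p' + U_(b)] -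
       lift_form K n d 'X_[p + U_(b)] * lift_form K n d 'X_[p' + U_(a)])) ->
  Pn_Od_property_QR K n d 3.
Proof.
move=> d_gt0 moves; exists (veronese_rank3 K n d); split; first by move=> q [].
move=> f; rewrite homog_ideal_veroneseE // -/(veronese_tuple K n d); split.
  apply: veronese_kernel_sub => // p p' a b i l i' l' Ei El Ei' El'.
  rewrite -(lift_formX K n d i) -(lift_formX K n d l).
  rewrite -(lift_formX K n d i') -(lift_formX K n d l').
  rewrite Ei El Ei' El'; apply: moves.
    by rewrite -(mdeg_veronese_monomial n d i) Ei mdegD mdeg1 addn1.
  by rewrite -(mdeg_veronese_monomial n d l) El mdegD mdeg1 addn1.
move=> [s [Ss ->]]; rewrite raddf_sum /= big_seq big1 // => c /Ss[_ c0].
by rewrite rmorphM /= c0 mulr0.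
Qed.

(** Write x_a for the coordinate of s^(d-a) t^a.  For g of degree d - 2, the
    squares g s^2 * g t^2 = (g s t)^2 give rank 3 quadrics quadratic in g.  For
    g a monomial this is x_a x_(a+2) - x_(a+1)^2; polarising in g gives
    x_a x_(b+2) + x_b x_(a+2) - 2 x_(a+1) x_(b+1).  With
    D(a, b) = x_a x_(b+1) - x_(a+1) x_b, the second family at (a, b - 1) is
    D(a, b) - D(a+1, b-1), so that D(a, b) is reached by induction on b - a in
    steps of 2, from D(a, a) = 0 and from the first family D(a, a+1). *)
Lemma QR3_P1 d : (1 < d)%N -> Pn_Od_property_QR K 1 d 3.
Proof.
move=> d_gt1; apply: QR3_of_moves; first exact: ltnW.
pose e a : 'X_{1..2} := (U_(ord0) *+ (d - a) + U_(ord_max) *+ a)%MM.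
pose x a := lift_form K 1 d 'X_[e a]; set J := ideal_gen _.
have homE a : (a <= d)%N -> ('X_[e a] : {mpoly K[2]}) \is d.-homog.
  by move=> le_a; rewrite dhomogX /= mdegD !mdegMn !mdeg1 !mul1n subnK.
(* g a is the form of degree d - 2 that e a, e a.+1, e a.+2 have in common. *)
pose g a : {mpoly K[2]} := 'X_ord0 ^+ (d - 2 - a) * 'X_ord_max ^+ a.
have e0 a : (a.+1 < d)%N -> 'X_[e a] = g a * 'X_ord0 ^+ 2.
  move=> lt_a; rewrite mpolyXD -!mpolyXn /g (_ : d - a = d - 2 - a + 2)%N; last lia.
  by rewrite exprD; ring.
have e1 a : (a.+1 < d)%N -> 'X_[e a.+1] = g a * ('X_ord0 * 'X_ord_max).
  move=> lt_a; rewrite mpolyXD -!mpolyXn /g (_ : d - a.+1 = (d - 2 - a).+1)%N; last lia.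
  by rewrite !exprS; ring.
have e2 a : (a.+1 < d)%N -> 'X_[e a.+2] = g a * 'X_ord_max ^+ 2.
  move=> lt_a; rewrite mpolyXD -!mpolyXn /g (_ : d - a.+2 = d - 2 - a)%N; last lia.
  by rewrite !exprS; ring.
have diag a : (a.+1 < d)%N -> J (x a * x a.+2 - x a.+1 ^+ 2).
  move=> lt_a; apply: lift_square; rewrite ?homE //; try lia.
  by rewrite (e0 a) // (e1 a) // (e2 a) //; ring.
have polar a b : (a.+1 < d)%N -> (b.+1 < d)%N ->
    J (x a * x b.+2 + x b * x a.+2 - 2%:R * (x a.+1 * x b.+1)).
  move=> lt_a lt_b; have Qab : J (lift_form K 1 d ('X_[e a] + 'X_[e b])
      * lift_form K 1 d ('X_[e a.+2] + 'X_[e b.+2])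
      - lift_form K 1 d ('X_[e a.+1] + 'X_[e b.+1]) ^+ 2).
    apply: lift_square; rewrite ?rpredD ?homE //; try lia.
    by rewrite (e0 a) // (e0 b) // (e1 a) // (e1 b) // (e2 a) // (e2 b) //; ring.
  have := ideal_genB _ _ _ _ (ideal_genB _ _ _ _ Qab (diag a lt_a)) (diag b lt_b).
  by congr J; rewrite !lift_formD -!/(x _); ring.
have D r : forall a, (a + r < d)%N -> J (x a * x (a + r).+1 - x a.+1 * x (a + r)%N).
  elim/ltn_ind: r => -[|[|r]] IHr a lt_ar.
  - by rewrite addn0 (_ : _ - _ = 0) ?subrr //; [apply: ideal_gen0 | ring].
  - by rewrite addn1 -expr2; apply: diag; lia.
  have := ideal_genD _ _ _ _ (polar a (a + r).+1 _ _) (IHr r _ a.+1 _).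
  rewrite !addnS addSn => H; have {H} := H ltac:(lia) ltac:(lia) ltac:(lia) ltac:(lia).
  by congr J; ring.
have Dab a b : (a < d)%N -> (b < d)%N -> J (x a * x b.+1 - x a.+1 * x b).
  move=> lt_a lt_b; case: (leqP a b) => [le_ab|/ltnW le_ba].
    by have := D (b - a)%N a; rewrite subnKC //; apply.
  have := D (a - b)%N b; rewrite subnKC // => /(_ lt_a)/ideal_genN.
  by congr J; ring.
have pE (p : 'X_{1..2}) : (mdeg p).+1 = d ->
    [/\ (p ord_max < d)%N, (p + U_(ord0))%MM = e (p ord_max)
      & (p + U_(ord_max))%MM = e (p ord_max).+1].
  rewrite mdegE !big_ord_recl big_ord0 => degp.
  have o1 : lift ord0 ord0 = ord_max :> 'I_2 by apply/val_inj.
  move: degp; rewrite o1 addn0 => degp.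
  split; first lia.
    apply/mnmP => i; rewrite !mnmDE !mulmnE !mnm1E.
    by case: (unliftP ord0 i) => [j ->|->]; [rewrite ord1 o1|]; rewrite /=; lia.
  apply/mnmP => i; rewrite !mnmDE !mulmnE !mnm1E.
  by case: (unliftP ord0 i) => [j ->|->]; [rewrite ord1 o1|]; rewrite /=; lia.
have ordE (i : 'I_2) : i = ord0 \/ i = ord_max.
  by case: i => [[|[|//]] lt_i]; [left | right]; apply: val_inj.
move=> p p' a b /pE[lt_p p0 p1] /pE[lt_p' p'0 p'1].
have [-> | ->] := ordE a; have [-> | ->] := ordE b.
- by rewrite subrr; apply: ideal_gen0.
- by rewrite p0 p1 p'0 p'1; apply: Dab.
- have /ideal_genN := Dab _ _ lt_p lt_p'; rewrite p0 p1 p'0 p'1 -!/(x _).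
  by congr J; ring.
- by rewrite subrr; apply: ideal_gen0.
Qed.

(** The ideal is generated by the 2 x 2 minors of the symmetric matrix of
    coordinates y_ij = x_i x_j.  Polarising y_ii y_jj - y_ij^2 in j yields all
    the minors in which a row index is also a column index.  For n <= 2 there
    are at most three indices, so two rows and two columns always share one. *)
Lemma QR3_deg2 n : (n <= 2)%N -> Pn_Od_property_QR K n 2 3.
Proof.
move=> n_le2; apply: QR3_of_moves => //; set J := ideal_gen _.
move=> p p' a b [/eqP/mdeg1P[c /eqP->]] [/eqP/mdeg1P[c' /eqP->]].
pose y i j := lift_form K n 2 ('X_i * 'X_j); rewrite !mpolyXD -!/(y _ _).
have yC i j : y i j = y j i by rewrite /y mulrC.
have homX i : ('X_i : {mpoly K[n.+1]}) \is 1.-homog by rewrite dhomogX /= mdeg1.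
have homM (F G : {mpoly K[n.+1]}) :
    F \is 1.-homog -> G \is 1.-homog -> F * G \is 2.-homog.
  exact: dhomogM.
have sq i j : J (y i i * y j j - y i j ^+ 2).
  by apply: lift_square; rewrite ?homM //; ring.
have minor i j k : J (y i i * y j k - y i j * y i k).
  have Q : J (y i i * lift_form K n 2 (('X_j + 'X_k) * ('X_j + 'X_k))
      - lift_form K n 2 ('X_i * ('X_j + 'X_k)) ^+ 2).
    by apply: lift_square; rewrite ?homM ?rpredD //; ring.
  have := ideal_genM _ _ (2%:R^-1)%:MP _
    (ideal_genB _ _ _ _ (ideal_genB _ _ _ _ Q (sq i j)) (sq i k)).
  congr J; rewrite !(mulrDl, mulrDr) !lift_formD -!/(y _ _) (yC k j).
  have e2 : (2%:R^-1)%:MP * 2%:R = 1 :> {mpoly K[(veronese_dim n 2).+1]}.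
    by rewrite -mpolyC_nat -mpolyCM mulVf.
  transitivity ((2%:R^-1)%:MP * 2%:R * (y i i * y j k - y i j * y i k)); first by ring.
  by rewrite e2 mul1r.
have [<-|ncc'] := eqVneq c c'.
  by rewrite (_ : _ - _ = 0); [apply: ideal_gen0 | ring].
have [<-|nab] := eqVneq a b; first by rewrite subrr; apply: ideal_gen0.
have [eca|nca] := eqVneq c a.
  by have := minor a c' b; congr J; rewrite eca (yC c' a); ring.
have [ecb|ncb] := eqVneq c b.
  have := ideal_genN _ _ _ (minor b c' a); congr J.
  by rewrite ecb (yC c' b); ring.
have [ec'a|nc'a] := eqVneq c' a.
  have := ideal_genN _ _ _ (minor a c b); congr J.
  by rewrite ec'a (yC c a); ring.
have [ec'b|nc'b] := eqVneq c' b.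
  by have := minor b c a; congr J; rewrite ec'b (yC c b); ring.
have := ltn_ord a; have := ltn_ord b; have := ltn_ord c; have := ltn_ord c'.
by move: ncc' nab nca ncb nc'a nc'b; rewrite -!val_eqE /=; lia.
Qed.

End QR.

(** * Products of quadratic forms that are squares *)

Section Forms.
Context (K : closedFieldType) (nz2 : 2%:R != 0 :> K).

Lemma closed_sqrt (x : K) : exists s, s ^+ 2 = x.
Proof.
have /closed_rootP[s] : size ('X^2 - x%:P) != 1%N by rewrite size_XnsubC.
by rewrite rootE !hornerE subr_eq0 => /eqP; exists s.
Qed.

Context (m : nat).
Implicit Types (A B C : 'M[K]_m) (x y v w u : 'rV[K]_m) (a b : K).

Definition bil A x y : K := (x *m A *m y^T) 0 0.
Definition lin u x : K := (x *m u^T) 0 0.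

Lemma bilDl A x y v : bil A (x + y) v = bil A x v + bil A y v.
Proof. by rewrite /bil !mulmxDl mxE. Qed.

Lemma bilDr A x y v : bil A x (y + v) = bil A x y + bil A x v.
Proof. by rewrite /bil linearD mulmxDr mxE. Qed.

Lemma bilZl A a x y : bil A (a *: x) y = a * bil A x y.
Proof. by rewrite /bil -!scalemxAl mxE. Qed.

Lemma bilZr A a x y : bil A x (a *: y) = a * bil A x y.
Proof. by rewrite /bil linearZ -scalemxAr mxE. Qed.

Lemma bilC A x y : A^T = A -> bil A x y = bil A y x.
Proof.
move=> symA; rewrite /bil (_ : x *m A *m y^T = (y *m A *m x^T)^T) ?mxE //.
by rewrite !trmx_mul trmxK symA mulmxA.
Qed.

Lemma bil_add A B x y : bil (A + B) x y = bil A x y + bil B x y.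
Proof. by rewrite /bil mulmxDr mulmxDl mxE. Qed.

Lemma bil_scale a A x y : bil (a *: A) x y = a * bil A x y.
Proof. by rewrite /bil -scalemxAr -scalemxAl mxE. Qed.

Lemma bil_opp A x y : bil (- A) x y = - bil A x y.
Proof. by rewrite -scaleN1r bil_scale mulN1r. Qed.

Lemma bil_outer u w x y : bil (u^T *m w) x y = lin u x * lin w y.
Proof.
rewrite /bil mulmxA -mulmxA mxE big_ord1; congr (_ * _).
by rewrite /lin -[w in LHS]trmxK -trmx_mul mxE.
Qed.

Lemma lin_mulmx A v x : lin (v *m A) x = bil A v x.
Proof. by rewrite /lin /bil -[x in LHS]trmxK -trmx_mul mxE. Qed.

Lemma lin_add u w x : lin (u + w) x = lin u x + lin w x.
Proof. by rewrite /lin linearD mulmxDr mxE. Qed.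

Lemma lin_scale a u x : lin (a *: u) x = a * lin u x.
Proof. by rewrite /lin linearZ -scalemxAr mxE. Qed.

Lemma linDr u x y : lin u (x + y) = lin u x + lin u y.
Proof. by rewrite /lin mulmxDl mxE. Qed.

Lemma linZr a u x : lin u (a *: x) = a * lin u x.
Proof. by rewrite /lin -scalemxAl mxE. Qed.

Lemma bil_line A v w t : A^T = A ->
  bil A (w + t *: v) (w + t *: v) = bil A w w + 2%:R * t * bil A v w + t ^+ 2 * bil A v v.
Proof.
by move=> symA; rewrite !bilDl !bilDr !bilZl !bilZr (bilC A w v symA); ring.
Qed.

Lemma bil_delta A i j : bil A (delta_mx 0 i) (delta_mx 0 j) = A i j.
Proof. by rewrite /bil -rowE trmx_delta -colE !mxE. Qed.

(** Isotropy on these finitely many vectors is enough, which makes the search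
    for an anisotropic vector in [sym_mx_anisotropic] decidable. *)
Lemma sym_mx0 A : A^T = A ->
  (forall i j, let x := delta_mx 0 i + delta_mx 0 j in bil A x x = 0) -> A = 0.
Proof.
move=> symA A0; have diag i : A i i = 0.
  have /eqP := A0 i i; rewrite /= !(bilDl, bilDr) !bil_delta.
  rewrite (_ : _ + _ = 2%:R ^+ 2 * A i i); last by ring.
  by rewrite mulf_eq0 expf_eq0 /= (negbTE nz2) => /eqP.
apply/matrixP => i j; rewrite mxE; have /eqP := A0 i j.
have Aji : A j i = A i j by rewrite -[in LHS]symA mxE.
rewrite /= !(bilDl, bilDr) !bil_delta !diag Aji.
rewrite (_ : _ + _ = 2%:R * A i j); last by ring.
by rewrite mulf_eq0 (negbTE nz2) => /eqP.
Qed.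

Lemma sym_mx_anisotropic A : A^T = A -> A != 0 -> exists v, bil A v v != 0.
Proof.
move=> symA nzA; pose x i j : 'rV[K]_m := delta_mx 0 i + delta_mx 0 j.
have [/existsP[i /existsP[j nz]]|] := boolP [exists i, exists j, bil A (x i j) (x i j) != 0].
  by exists (x i j).
rewrite negb_exists => /forallP all0; case/eqP: nzA; apply: sym_mx0 => // i j /=.
by have := all0 i; rewrite negb_exists => /forallP/(_ j); rewrite negbK => /eqP.
Qed.

Lemma quad_form_domain A B : (forall x, bil A x x * bil B x x = 0) ->
  (forall x, bil A x x = 0) \/ (forall x, bil B x x = 0).
Proof.
pose P A : {mpoly K[m]} := \sum_i \sum_j A i j *: ('X_i * 'X_j).
have evP E (v : 'I_m -> K) : (P E).@[v] = bil E (\row_i v i) (\row_i v i).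
  rewrite /P raddf_sum /bil mxE /=.
  under [RHS]eq_bigr do rewrite !mxE mulr_suml.
  rewrite exchange_big /=; apply: eq_bigr => i _.
  rewrite raddf_sum; apply: eq_bigr => j _ /=.
  by rewrite mevalZ mevalM !mevalXU !mxE; ring.
move=> AB0; have /eqP : P A * P B = 0.
  by apply: mpoly_eval0 => v; rewrite mevalM !evP.
rewrite mulf_eq0; have rowE x : x = \row_i x 0 i by apply/rowP => i; rewrite mxE.
by case/orP=> /eqP P0; [left | right] => x; rewrite (rowE x) -evP P0 meval0.
Qed.

Lemma sym_outer u : (u^T *m u)^T = u^T *m u.
Proof. by rewrite trmx_mul trmxK. Qed.

Lemma outerZ a u : (a *: u)^T *m (a *: u) = a ^+ 2 *: (u^T *m u).
Proof. by rewrite [(a *: u)^T]linearZ /= -scalemxAl -scalemxAr scalerA expr2. Qed.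

Lemma symB A B : A^T = A -> B^T = B -> (A - B)^T = A - B.
Proof. by move=> eA eB; rewrite linearB /= eA eB. Qed.

Lemma symZ a A : A^T = A -> (a *: A)^T = a *: A.
Proof. by move=> eA; rewrite linearZ /= eA. Qed.

Lemma sym_quad0 A : A^T = A -> (forall x, bil A x x = 0) -> A = 0.
Proof. by move=> symA A0; apply: sym_mx0 => // i j; apply: A0. Qed.

(** A substitute for unique factorisation.  If A != 0, restrict the forms to the
    lines w + t v in a fixed direction v with A(v) != 0.  There A becomes a
    quadratic polynomial in t whose discriminant is 4 E(w).  When E(w) != 0 it
    has two distinct roots t, at which C vanishes as well; the combination F of
    A and C without t^2 term then has two roots, hence vanishes at w.
    So E F = 0 as functions, and E = 0 or F = 0.  If E = 0 then A is the square
    of a linear form u, and C vanishes on the hyperplane u = 0, hence is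
    divisible by u; the quotient w gives B = w^2.  If F = 0 then C is a multiple
    of A, and B is found after cancelling A. *)
Lemma product_square_forms A B C : A^T = A -> B^T = B -> C^T = C ->
  (forall x, bil A x x * bil B x x = bil C x x ^+ 2) ->
  (exists D a b c, [/\ A = a *: D, B = b *: D, C = c *: D & a * b = c ^+ 2]) \/
  (exists u w, [/\ A = u^T *m u, B = w^T *m w & 2%:R *: C = u^T *m w + w^T *m u]).
Proof.
move=> symA symB' symC ABC.
have [A0|nzA] := eqVneq A 0.
  left; exists B, 0, 1, 0; rewrite scale0r scale1r mul0r expr0n; split=> //.
  apply: sym_quad0 => // x; have /esym/eqP := ABC x.
  by rewrite A0 -(scale0r A) bil_scale !mul0r expf_eq0 => /eqP.
have [v nza] := sym_mx_anisotropic A symA nzA; set a := bil A v v in nza.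
pose c := bil C v v; pose E := (v *m A)^T *m (v *m A) - a *: A.
pose F := a *: C - c *: A.
have symE : E^T = E by apply/symB/symZ => //; apply: sym_outer.
have symF : F^T = F by apply: symB; apply: symZ.
have EF0 w : bil E w w * bil F w w = 0.
  have [->|nzE] := eqVneq (bil E w w) 0; first by rewrite mul0r.
  have [s Es] := closed_sqrt (bil E w w).
  have nzs : s != 0 by apply: contra nzE => /eqP s0; rewrite -Es s0 expr0n.
  have Ew : bil E w w = bil A v w ^+ 2 - a * bil A w w.
    by rewrite bil_add bil_opp bil_scale bil_outer lin_mulmx expr2.
  have Fv : bil F v v = 0.
    by rewrite bil_add bil_opp !bil_scale -/a -/c; ring.
  have root t : t ^+ 2 = s ^+ 2 -> bil F w w * a + 2%:R * (t - bil A v w) * bil F v w = 0.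
    move=> Et; pose z := w + ((t - bil A v w) / a) *: v.
    have Az : bil A z z = 0.
      apply: (mulfI nza); rewrite mulr0 bil_line // -/a.
      transitivity (t ^+ 2 - (bil A v w ^+ 2 - a * bil A w w)); first by field.
      by rewrite Et Es Ew subrr.
    have Cz : bil C z z = 0.
      by have /esym/eqP := ABC z; rewrite Az mul0r expf_eq0 => /eqP.
    have : bil F z z = 0 by rewrite bil_add bil_opp !bil_scale Az Cz !mulr0 subr0.
    rewrite bil_line // Fv mulr0 addr0 => /(congr1 ( *%R^~ a)); rewrite mul0r => <-.
    by field.
  have r1 := root s erefl; have := root (- s); rewrite sqrrN => /(_ erefl) r2.
  have Fvw : bil F v w = 0.
    have /eqP : 2%:R * 2%:R * s * bil F v w = 0.
      by rewrite -[RHS](subrr 0) -{1}r1 -r2; ring.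
    by rewrite !mulf_eq0 !(negbTE nz2) (negbTE nzs) => /eqP.
  move: r1; rewrite Fvw mulr0 addr0 => /eqP; rewrite mulf_eq0 (negbTE nza) orbF => /eqP->.
  by rewrite mulr0.
have [E0|F0] := quad_form_domain E F EF0; [right|left].
  have {}E0 := sym_quad0 E symE E0.
  have [u Au] : exists u, A = u^T *m u.
    have [r Er] := closed_sqrt a^-1; exists (r *: (v *m A)); have /eqP := E0; rewrite subr_eq0 => /eqP EA.
    by rewrite outerZ Er EA scalerA mulVf // scale1r.
  have quadA x : bil A x x = lin u x ^+ 2 by rewrite Au bil_outer.
  pose k := lin u v; have nzk : k != 0.
    by apply: contra nza => /eqP k0; rewrite /a quadA -/k k0 expr0n.
  pose w := (2%:R / k) *: (v *m C) - (c / k ^+ 2) *: u.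
  have Cw x : bil C x x = lin u x * lin w x.
    (* z is the projection of x along v onto the hyperplane u = 0. *)
    pose z := x + (- (lin u x / k)) *: v.
    have Az : bil A z z = 0.
      have uz : lin u z = 0.
        by rewrite linDr linZr -/k; field.
      by rewrite quadA uz expr0n.
    have Cz : bil C z z = 0.
      by have /esym/eqP := ABC z; rewrite Az mul0r expf_eq0 => /eqP.
    move: Cz; rewrite bil_line // -/c => /eqP; rewrite -addrA addr_eq0 => /eqP ->.
    rewrite /w lin_add -scaleNr !lin_scale lin_mulmx; by field.
  exists u, w; split=> //.
    have [] // := quad_form_domain A (B - w^T *m w).
    - by move=> x; rewrite bil_add bil_opp bil_outer mulrBr ABC quadA Cw; ring.
    - by move=> A0; case/eqP: nzA; apply: sym_quad0.
    - move=> B0; apply/eqP; rewrite -subr_eq0; apply/eqP; apply: sym_quad0 => //.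
      by apply: symB => //; apply: sym_outer.
  apply/eqP; rewrite -subr_eq0; apply/eqP; apply: sym_quad0.
    apply: symB; first exact: symZ.
    by rewrite linearD /= !trmx_mul !trmxK addrC.
  move=> x; rewrite bil_add bil_opp bil_scale bil_add !bil_outer Cw; ring.
have {}F0 : a *: C = c *: A.
  by apply/eqP; rewrite -subr_eq0; apply/eqP; apply: sym_quad0 F0.
have EC : C = (c / a) *: A.
  by apply: (scalerI nza); rewrite F0 scalerA mulrC divfK.
exists A, 1, ((c / a) ^+ 2), (c / a); rewrite scale1r mul1r; split=> //.
have [] // := quad_form_domain A (B - (c / a) ^+ 2 *: A).
- by move=> x; rewrite bil_add bil_opp bil_scale mulrBr ABC EC bil_scale; ring.
- by move=> A0; case/eqP: nzA; apply: sym_quad0.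
move=> B0; apply/eqP; rewrite -subr_eq0; apply/eqP; apply: sym_quad0 => //.
by apply: symB => //; apply: symZ.
Qed.

(** The left-hand side is the coefficient of y_ij y_kl in the quadric
    ab - c^2 attached to A B = C^2, up to a constant.  It vanishes when A, B, C
    are proportional.  When A = u^2, B = w^2 and C = u w it is the sum of
    u_i u_j w_k w_l + u_k u_l w_i w_j and of -1/2 times the four other
    products of the same shape; since -1/2 = 1 in characteristic 3, all six
    products have the same coefficient and the sum is symmetric in i, j, k, l. *)
Lemma char3_symmetry A B C i j k l : 3%N \in [pchar K] ->
  A^T = A -> B^T = B -> C^T = C ->
  (forall x, bil A x x * bil B x x = bil C x x ^+ 2) ->
  A i j * B k l + A k l * B i j - 2%:R * (C i j * C k l) =
  A i k * B j l + A j l * B i k - 2%:R * (C i k * C j l).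
Proof.
move=> charK3 symA symB' symC ABC; have K3 : 3%:R = 0 :> K := pcharf0 charK3.
have [[D [a [b [c [-> -> -> abc]]]]]|] := product_square_forms A B C symA symB' symC ABC.
  have T0 p q : a * p * (b * q) + a * q * (b * p) - 2%:R * (c * p * (c * q)) = 0.
    by transitivity (2%:R * (a * b - c ^+ 2) * p * q); [ring|rewrite abc; ring].
  by rewrite !mxE !T0.
move=> [u [w [-> -> Cuw]]].
(* C = (u w + w u) / 2 and 1/2 = -1. *)
have CE p q : C p q = - (u 0 p * w 0 q + w 0 p * u 0 q).
  have := congr1 (fun M : 'M_m => M p q) Cuw; rewrite !mxE !big_ord1 !mxE => <-.
  by transitivity (C p q * (1 - 3%:R)); [rewrite K3|]; ring.
rewrite !CE !mxE !big_ord1 !mxE; apply/eqP; rewrite -subr_eq0; apply/eqP.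
set ui := u 0 i; set uj := u 0 j; set uk := u 0 k; set ul := u 0 l.
set wi := w 0 i; set wj := w 0 j; set wk := w 0 k; set wl := w 0 l.
transitivity (3%:R * (ui * uj * wk * wl + uk * ul * wi * wj
  - ui * uk * wj * wl - uj * ul * wi * wk)); first by ring.
by rewrite K3 mul0r.
Qed.

(** A sum of three squares is put in the form AB - C^2 by means of a square
    root of -1. *)
Lemma char3_sum_squares (A0 A1 A2 : 'M[K]_m) i j k l : 3%N \in [pchar K] ->
  A0^T = A0 -> A1^T = A1 -> A2^T = A2 ->
  (forall x, bil A0 x x ^+ 2 + bil A1 x x ^+ 2 + bil A2 x x ^+ 2 = 0) ->
  A0 i j * A0 k l + A1 i j * A1 k l + A2 i j * A2 k l =
  A0 i k * A0 j l + A1 i k * A1 j l + A2 i k * A2 j l.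
Proof.
move=> charK3 sym0 sym1 sym2 sum0; have [I EI] := closed_sqrt (-1).
have sym_lin a : (A0 + a *: A1)^T = A0 + a *: A1 by rewrite linearD linearZ /= sym0 sym1.
have ABC x : bil (A0 + I *: A1) x x * bil (A0 + (- I) *: A1) x x =
    bil (I *: A2) x x ^+ 2.
  rewrite !bil_add !bil_scale exprMn EI.
  transitivity (bil A0 x x ^+ 2 - I ^+ 2 * bil A1 x x ^+ 2); first by ring.
  by apply/eqP; rewrite EI -subr_eq0; apply/eqP; rewrite -[RHS](sum0 x); ring.
have := char3_symmetry _ _ _ i j k l charK3 (sym_lin I) (sym_lin (- I)) (symZ I _ sym2) ABC.
have T (a b c d : 'I_m) : (A0 + I *: A1) a b * (A0 + (- I) *: A1) c d
    + (A0 + I *: A1) c d * (A0 + (- I) *: A1) a b - 2%:R * ((I *: A2) a b * (I *: A2) c d)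
    = 2%:R * (A0 a b * A0 c d + A1 a b * A1 c d + A2 a b * A2 c d).
  rewrite !mxE.
  transitivity (2%:R * (A0 a b * A0 c d - I ^+ 2 * (A1 a b * A1 c d)
    - I ^+ 2 * (A2 a b * A2 c d))); first by ring.
  by rewrite EI; ring.
by rewrite !T => /(mulfI nz2).
Qed.

(** Completing the square at a vector v with A(v) != 0: what remains kills v,
    which A does not, so the rank drops. *)
Lemma sym_mx_gram A k : A^T = A -> (\rank A <= k)%N ->
  exists U : 'M[K]_(k, m), A = U^T *m U.
Proof.
elim: k A => [|k IHk] A symA rkA.
  exists 0; move: rkA; rewrite leqn0 mxrank_eq0 => /eqP->.
  by rewrite mulmx0.
have [->|nzA] := eqVneq A 0; first by exists 0; rewrite mulmx0.
have [v nza] := sym_mx_anisotropic A symA nzA; set a := bil A v v in nza.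
pose B := A - a^-1 *: ((v *m A)^T *m (v *m A)).
have symB' : B^T = B by apply/symB/symZ => //; apply: sym_outer.
have leBA : (B <= A)%MS.
  by rewrite addmx_sub // eqmx_opp scalemx_sub // mulmxA submxMl.
have ltBA : (B < A)%MS.
  rewrite ltmxE leBA; apply/negP => /submxP[X EX].
  have Bv : B *m v^T = 0.
    rewrite mulmxBl -scalemxAl -mulmxA [v *m A *m _]mx11_scalar -/(bil A v v) -/a.
    by rewrite mul_mx_scalar scalerA mulVf // scale1r trmx_mul symA subrr.
  by case/eqP: nza; rewrite /a /bil EX -!mulmxA Bv !mulmx0 mxE.
have [|U EU] := IHk B symB'.
  by move: ltBA; rewrite ltmxErank leBA => /leq_trans/(_ rkA).
have [r Er] := closed_sqrt a^-1.
rewrite -add1n; exists (col_mx (r *: (v *m A)) U).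
by rewrite tr_col_mx mul_row_col -EU outerZ Er addrC subrK.
Qed.

End Forms.
Arguments bil {K m} A x y.

(** * The obstruction in characteristic three *)

Lemma mcoeffM_homog (K : fieldType) m e (p q : {mpoly K[m]}) (u : 'X_{1..m}) :
  q \is e.-homog -> mdeg u = e -> (p * q)@_u = p@_0 * q@_u.
Proof.
move=> hq du; rewrite {1}[p]mpolyE mulr_suml raddf_sum /=.
have term w : (p@_w *: 'X_[w] * q)@_u = (w == 0%MM)%:R * (p@_w * q@_u).
  rewrite -scalerAl mcoeffZ; have [->|nw] := eqVneq w 0%MM.
    by rewrite mpolyX0 !mul1r.
  have hw : 'X_[w] * q \is (mdeg w + e).-homog by apply: dhomogM; rewrite ?dhomogX.
  rewrite mul0r (dhomog_nemf_coeff hw) ?mulr0 //= du -[X in X == _]add0n eqn_add2r.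
  by rewrite eq_sym mdeg_eq0.
under eq_bigr do rewrite term.
have [p0|p0] := boolP (0%MM \in msupp p).
  rewrite (bigD1_seq 0%MM) ?msupp_uniq //= eqxx mul1r big1 ?addr0 // => w /negbTE nw.
  by rewrite nw mul0r.
rewrite (memN_msupp_eq0 p0) mul0r big_seq big1 // => w wp.
by case: eqP p0 => [<-|_ _]; rewrite ?wp // mul0r.
Qed.

Section Obstruction.
Context (K : closedFieldType) (charK3 : 3%N \in [pchar K]).
Context (n : nat).
Local Notation N := (veronese_dim n 2).
Local Notation mon := (@veronese_monomial n 2).

Lemma char3_nz2 : 2%:R != 0 :> K.
Proof.
have K3 : 3%:R = 0 :> K := pcharf0 charK3.
apply/eqP => K2; have /eqP[] := oner_neq0 K.
by transitivity (3%:R - 2%:R : K); [ring | rewrite K3 K2 subrr].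
Qed.
Let nz2 := char3_nz2.

Lemma bil_quadric_mx m (p : {mpoly K[m]}) (x : 'rV[K]_m) : p \is 2.-homog ->
  bil (quadric_mx p) x x = p.@[fun i => x 0 i].
Proof.
move=> hp; rewrite [in RHS](quadric_mxE nz2 hp) raddf_sum /bil mxE /=.
under eq_bigr do rewrite !mxE mulr_suml.
rewrite exchange_big /=; apply: eq_bigr => i _.
rewrite raddf_sum; apply: eq_bigr => j _ /=.
by rewrite mevalZ mevalM !mevalXU; ring.
Qed.

Lemma rank3_sum_squares m (q : {mpoly K[m]}) : quadric_rank_le 3 q ->
  exists U : 'M[K]_(3, m), quadric_mx q = U^T *m U /\
    q = \sum_t linear_form (row t U) ^+ 2.
Proof.
move=> [hq rq]; have [U EU] := sym_mx_gram K nz2 m _ 3 (quadric_mx_sym q) rq.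
exists U; split=> //; rewrite [LHS](quadric_mxE nz2 hq) EU.
have sq t : linear_form (row t U) ^+ 2 =
    \sum_i \sum_j (U t i * U t j) *: ('X_i * 'X_j).
  rewrite expr2 mulr_suml; apply: eq_bigr => i _; rewrite mulr_sumr.
  by apply: eq_bigr => j _; rewrite !mxE -scalerAl -scalerAr scalerA.
rewrite (eq_bigr _ (fun t _ => sq t)) [RHS]exchange_big; apply: eq_bigr => i _ /=.
rewrite [RHS]exchange_big; apply: eq_bigr => j _ /=.
by rewrite mxE scaler_suml; apply: eq_bigr => t _; rewrite !mxE.
Qed.

(** A quadric of rank at most 3 is a sum of three squares of linear forms; the
    restrictions of these to the Veronese variety are quadratic forms G t whose
    squares add up to 0, and the coefficients of the quadric are expressed by
    those of the G t.  The conclusion is then [char3_sum_squares]. *)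
Lemma rank3_coef_symmetry (q : {mpoly K[N.+1]}) (i j k l : 'I_n.+1)
    (ij kl ik jl : 'I_N.+1) :
  i != j -> k != l -> i != k -> j != l ->
  (U_(i) + U_(j))%MM = mon ij -> (U_(k) + U_(l))%MM = mon kl ->
  (U_(i) + U_(k))%MM = mon ik -> (U_(j) + U_(l))%MM = mon jl ->
  quadric_rank_le 3 q -> q \mPo veronese_tuple K n 2 = 0 ->
  quadric_mx q ij kl = quadric_mx q ik jl.
Proof.
move=> nij nkl nik njl Eij Ekl Eik Ejl /rank3_sum_squares[U [-> ->]].
pose G t := linear_form (row t U) \mPo veronese_tuple K n 2.
have GE t : G t = \sum_a U t a *: 'X_[mon a].
  rewrite /G raddf_sum; apply: eq_bigr => a _ /=.
  by rewrite comp_mpolyZ veronese_substX image_monomialU mxE.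
have hG t : G t \is 2.-homog.
  rewrite GE; apply: rpred_sum => a _; apply: dhomogZ.
  by rewrite dhomogX /= mdeg_veronese_monomial.
have coefG t a b ab : a != b -> (U_(a) + U_(b))%MM = mon ab ->
    U t ab = 2%:R * quadric_mx (G t) a b.
  move=> /negbTE nab Eab; rewrite mxE nab Eab GE raddf_sum /=.
  rewrite (bigD1 ab) //= big1 => [|c /negbTE nc].
    by rewrite mcoeffZ mcoeffX eqxx mulr1 addr0; field.
  by rewrite mcoeffZ mcoeffX (inj_eq (@veronese_monomial_inj n 2)) nc mulr0.
rewrite raddf_sum /= => /(_ =P _) sum0.
have big3 (V : nmodType) (F : 'I_3 -> V) :
    \sum_t F t = F ord0 + F (inord 1) + F (inord 2).
  rewrite !big_ord_recl big_ord0 addr0 addrA.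
  by congr (_ + F _ + F _); apply: val_inj; rewrite /= inordK.
have sq0 : (G ord0) ^+ 2 + (G (inord 1)) ^+ 2 + (G (inord 2)) ^+ 2 = 0.
  move/eqP: sum0; rewrite big3 => <-; by rewrite !rmorphXn.
clearbody G; have sum_sq x : bil (quadric_mx (G ord0)) x x ^+ 2 + bil (quadric_mx (G (inord 1))) x x ^+ 2
    + bil (quadric_mx (G (inord 2))) x x ^+ 2 = 0.
  rewrite !(bil_quadric_mx _ _ _ (hG _)).
  have := congr1 (meval (fun i => x 0 i)) sq0.
  by rewrite meval0 !mevalD !rmorphXn.
have e := char3_sum_squares K nz2 _ _ _ _ i j k l charK3 (quadric_mx_sym _)
  (quadric_mx_sym _) (quadric_mx_sym _) sum_sq.
have prod a b c d ab cd : a != b -> c != d ->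
    (U_(a) + U_(b))%MM = mon ab -> (U_(c) + U_(d))%MM = mon cd ->
    (U^T *m U) ab cd = 2%:R * 2%:R * (quadric_mx (G ord0) a b * quadric_mx (G ord0) c d
     + quadric_mx (G (inord 1)) a b * quadric_mx (G (inord 1)) c d + quadric_mx (G (inord 2)) a b * quadric_mx (G (inord 2)) c d).
  move=> nab ncd Eab Ecd; have trE (t : 'I_3) v : U^T v t = U t v by rewrite mxE.
  rewrite mxE big3 !trE !(coefG _ _ _ _ nab Eab) !(coefG _ _ _ _ ncd Ecd).
  move: (quadric_mx (G ord0)) (quadric_mx (G (inord 1))) (quadric_mx (G (inord 2))) => A0 A1 A2; ring.
by rewrite (prod i j k l) // (prod i k j l) // e.
Qed.

(** With four variables x_0, ..., x_3 at hand, the quadric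
    y_01 y_23 - y_02 y_13 lies in the ideal.  The functional L, the difference
    of the coefficients of y_01 y_23 and of y_02 y_13, kills all quadrics of
    rank at most 3 of the ideal, hence the degree 2 part of what they generate,
    but it takes the value 2 on that quadric. *)
Lemma not_QR3_deg2 : (2 < n)%N -> ~ Pn_Od_property_QR K n 2 3.
Proof.
move=> n_gt2 [S [S_rank S_gen]].
pose x k : 'I_n.+1 := inord k.
have nx a b : (a < 4)%N -> (b < 4)%N -> a != b -> x a != x b.
  by move=> lta ltb; apply: contra => /eqP/(congr1 val); rewrite /= !inordK; try lia; move->.
have ex a b : exists i, (U_(x a) + U_(x b))%MM = mon i.
  by apply/veronese_monomialP; rewrite mdegD !mdeg1.
have [i01 E01] := ex 0 1; have [i23 E23] := ex 2 3.
have [i02 E02] := ex 0 2; have [i13 E13] := ex 1 3.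
have neq a b c d i j : (U_(x a) + U_(x b))%MM = mon i -> (U_(x c) + U_(x d))%MM = mon j ->
    [&& a < 4, b < 4, c < 4 & d < 4]%N -> a \notin [:: c; d] -> i != j.
  move=> Ei Ej /and4P[la lb lc ld]; rewrite !inE negb_or => /andP[nac nad].
  apply/eqP => eij; have /eqP := Ei; rewrite eij -Ej mnm_addU_eq.
  by rewrite (negbTE (nx _ _ la lc nac)) (negbTE (nx _ _ la ld nad)).
pose f : {mpoly K[N.+1]} := 'X_i01 * 'X_i23 - 'X_i02 * 'X_i13.
have /S_gen[s [Ss Ef]] : homog_ideal (@veronese_variety K n 2) f.
  apply/homog_ideal_veroneseE; rewrite // -/(veronese_tuple K n 2) /f.
  rewrite raddfB /= -!mpolyXD !veronese_substX !image_monomialD !image_monomialU.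
  rewrite -E01 -E23 -E02 -E13; apply/eqP; rewrite subr_eq0; apply/eqP.
  by congr 'X_[_]; apply/mnmP => c; rewrite !mnmDE; lia.
have nd0 : i01 != i23 by apply: (neq 0 1 2 3).
have nd1 : i02 != i13 by apply: (neq 0 2 1 3).
pose L (g : {mpoly K[N.+1]}) := g@_(U_(i01) + U_(i23)) - g@_(U_(i02) + U_(i13)).
have L0 c q : S q -> L (c * q) = 0.
  move=> Sq; have [hq rq] := S_rank q Sq.
  rewrite /L !(mcoeffM_homog _ _ _ _ _ _ hq) ?mdegD ?mdeg1 // -mulrBr.
  have q0 : q \mPo veronese_tuple K n 2 = 0.
    by apply/homog_ideal_veroneseE => //; apply/S_gen; apply: ideal_gen_in.
  have := rank3_coef_symmetry q _ _ _ _ _ _ _ _ (nx 0 1 _ _ _) (nx 2 3 _ _ _)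
    (nx 0 2 _ _ _) (nx 1 3 _ _ _) E01 E23 E02 E13 (S_rank q Sq) q0.
  move=> /(_ isT isT isT isT isT isT isT isT isT isT isT isT).
  rewrite !mxE (negbTE nd0) (negbTE nd1) => /(mulIf _) ->; last by rewrite invr_eq0.
  by rewrite subrr mulr0.
have : L f = 0.
  have -> : L f = \sum_(c <- s) L (c.1 * c.2).
    by rewrite /L Ef !raddf_sum -big_split.
  by rewrite big_seq big1 // => c /Ss Sc; apply: L0.
have ne : (U_(i01) + U_(i23) == U_(i02) + U_(i13))%MM = false.
  rewrite mnm_addU_eq [i23 == i13](negbTE (neq 2 3 1 3 _ _ E23 E13 isT isT)).
  by rewrite [i01 == i13](negbTE (neq 0 1 1 3 _ _ E01 E13 isT isT)) andbF.
rewrite /L /f !mcoeffB -!mpolyXD !mcoeffX !eqxx ne eq_sym ne.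
by rewrite subr0 sub0r opprK -natrD; apply/eqP.
Qed.

End Obstruction.

Theorem theorem1p2 (K : closedFieldType) (charK3 : 3%N \in [pchar K]) :
  (forall d : nat, (2 <= d)%N -> Pn_Od_property_QR K 1 d 3) /\
  (forall n : nat, (0 < n)%N -> (Pn_Od_property_QR K n 2 3 <-> (n <= 2)%N)).
Proof.
have nz2 := char3_nz2 K charK3; split=> [d d_gt1|n _]; first exact: QR3_P1.
split=> [QR|]; last exact: QR3_deg2.
by rewrite leqNgt; apply/negP => n_gt2; apply: not_QR3_deg2 QR.
Qed.
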